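(* Let $(H_w,H_r)$ be a target pair satisfying exchange closure (EC), and let $n$ be a $w$-vertex with $h_n>\rho_1$. Then for all $0\le m\le b_r$ $$\bar H_w(n-1+m)\ \ge\ \frac{n-1}{n}H_w(n)+H_r(m),$$ and, if moreover $n\ge 3$, for all $0\le m\le b_r$ $$\bar H_w(m+1)\ \ge\ \frac1n H_w(n)+H_r(m).$$
   Context: A target pair $(H_w,H_r)$ consists of strictly increasing concave rational sequences $H_\alpha$ on $\{0,\dots,b_\alpha\}$, $\alpha\in\{w,r\}$, with $H_\alpha(0)=0$ (the zero sequence, $b_\alpha=0$, is allowed). $h_n=H_w(n)-H_w(n-1)$, $\rho_m=H_r(m)-H_r(m-1)$, $\rho_1:=0$ if $b_r=0$; $\bar H_\alpha(k)=H_\alpha(\min\{k,b_\alpha\})$. A positive count $n\le b_\alpha$ is an $\alpha$-vertex if $n=b_\alpha$ or the slopes of $H_\alpha$ immediately before and after $n$ differ. Dominance means $H_r(k)\le\bar H_w(k)$ for $0\le k\le b_r$. There is no cardinality cap. Exchange closure (EC). The pair satisfies EC if dominance holds and there is an admissible witness, consisting of: for each $w$-vertex $n$, an $n$-element labeled set $X_n$ with rational values $x_{n,i}$, a long/short label for each member, and a downward-closed family $\mathcal F_n$ of subsets of $X_n$ (the declared $r$-feasible subsets) containing $\varnothing$ and whose singletons are precisely the short members; for each $r$-vertex $m$, an $m$-element set $Z_m$ with rational values $z_{m,j}$; for each such $(n,m)$, a subset $O_{n,m}\subseteq X_n$ with $O_{n,m}\in\mathcal F_n$ and a map $\pi_{n,m}:O_{n,m}\to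 Z_m$; such that: (EC1) $0\le x_{n,i}\le H_w(1)$, short values are at most $\rho_1$, $\sum_i x_{n,i}=H_w(n)$; every $S\subseteq X_n$ has total value at most $\bar H_w(|S|)$, and every $S\in\mathcal F_n$ has total value at most $\bar H_r(|S|)$. (EC2) $0\le z_{m,j}\le\rho_1$, $\sum_j z_{m,j}=H_r(m)$, and every $S\subseteq Z_m$ has total value at most $\bar H_r(|S|)$. (EC3) $\pi_{n,m}$ is injective, $O_{n,m}$ contains only short members, and $x_{n,i}=z_{m,\pi_{n,m}(i)}$ for $i\in O_{n,m}$. (EC4) For every $(n,m)$ and every long $i\in X_n$, with $k=|O_{n,m}|$, $\bar H_w(n-1+m-k)\ge H_w(n)-x_{n,i}+H_r(m)-\sum_{i'\in O_{n,m}}z_{m,\pi_{n,m}(i')}$. (EC5) For every $(n,m)$, every two-element subset $\{i,i'\}\subseteq X_n$ with $\{i,i'\}\notin\mathcal F_n$, and every $y\in X_n\setminus(\{i,i'\}\cup O_{n,m})$, $\bar H_w(m+1)\ge x_{n,y}+H_r(m)$. If $b_r=0$ there are no $r$-vertices and the conditions quantifying over $m$ are vacuous. *)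

(* Defs.v *)
From mathcomp Require Import all_boot all_order all_algebra.
Set Implicit Arguments.
Unset Strict Implicit.
Unset Printing Implicit Defensive.
Import Order.TTheory GRing.Theory Num.Theory.
Local Open Scope ring_scope.

(* Only the restriction of [tval] to {0, ..., bound} is meaningful: the values
   beyond [bound] are unconstrained and never matter below. *)
Record target := Target {
  bound : nat;
  tval :> nat -> rat;
  tval0 : tval 0 = 0;
  tval_incr : forall k, (k < bound)%N -> tval k < tval k.+1;
  tval_concave : forall k, (0 < k)%N -> (k < bound)%N ->
    tval k.+1 - tval k <= tval k - tval k.-1
}.

Definition slope (H : target) (n : nat) : rat := H n - H n.-1.

Definition slope1 (H : target) : rat :=
  if bound H == 0%N then 0 else slope H 1.

Definition bar (H : target) (k : nat) : rat := H (minn k (bound H)).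

Definition vertex (H : target) (n : nat) : bool :=
  [&& (0 < n)%N, (n <= bound H)%N & (n == bound H) || (slope H n != slope H n.+1)].

Definition dominance (Hw Hr : target) : Prop :=
  forall k, (k <= bound Hr)%N -> Hr k <= bar Hw k.

(* The labeled sets X_n and Z_m are 'I_n and 'I_m. The data is indexed by all
   n and m, but [admissible] constrains it at vertices only. *)
Record witness := Witness {
  xval : forall n, 'I_n -> rat;
  short : forall n, {set 'I_n};
  feas : forall n, {set {set 'I_n}};
  zval : forall m, 'I_m -> rat;
  ovl : forall n m : nat, {set 'I_n};
  ovl_map : forall n m, {i : 'I_n | i \in ovl n m} -> 'I_m
}.

Definition feas_ok (Hw : target) (W : witness) : Prop :=
  forall n, vertex Hw n ->
  [/\ set0 \in feas W n,
      forall S T : {set 'I_n}, T \subset S -> S \in feas W n -> T \in feas W n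
    & forall i : 'I_n, ([set i] \in feas W n) = (i \in short W n)].

Definition EC1 (Hw Hr : target) (W : witness) : Prop :=
  forall n, vertex Hw n ->
  [/\ forall i : 'I_n, 0 <= xval W i <= Hw 1%N,
      forall i : 'I_n, i \in short W n -> xval W i <= slope1 Hr,
      \sum_(i < n) xval W i = Hw n,
      forall S : {set 'I_n}, \sum_(i in S) xval W i <= bar Hw #|S|
    & forall S : {set 'I_n}, S \in feas W n ->
        \sum_(i in S) xval W i <= bar Hr #|S|].

Definition EC2 (Hr : target) (W : witness) : Prop :=
  forall m, vertex Hr m ->
  [/\ forall j : 'I_m, 0 <= zval W j <= slope1 Hr,
      \sum_(j < m) zval W j = Hr m
    & forall S : {set 'I_m}, \sum_(j in S) zval W j <= bar Hr #|S|].

Definition EC3 (Hw Hr : target) (W : witness) : Prop :=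
  forall n m, vertex Hw n -> vertex Hr m ->
  [/\ ovl W n m \in feas W n,
      injective (@ovl_map W n m),
      ovl W n m \subset short W n
    & forall i : {i : 'I_n | i \in ovl W n m},
        xval W (val i) = zval W (ovl_map i)].

(* The subtraction is exact: [ovl_map] is injective, so #|ovl W n m| <= m. *)
Definition EC4 (Hw Hr : target) (W : witness) : Prop :=
  forall n m, vertex Hw n -> vertex Hr m ->
  forall i : 'I_n, i \notin short W n ->
  bar Hw (n.-1 + m - #|ovl W n m|) >=
    Hw n - xval W i + Hr m
    - \sum_(i' : {i : 'I_n | i \in ovl W n m}) zval W (ovl_map i').

Definition EC5 (Hw Hr : target) (W : witness) : Prop :=
  forall n m, vertex Hw n -> vertex Hr m ->
  forall i i' : 'I_n, i != i' -> [set i; i'] \notin feas W n ->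
  forall y : 'I_n, y \notin [set i; i'] :|: ovl W n m ->
  bar Hw m.+1 >= xval W y + Hr m.

Definition admissible (Hw Hr : target) (W : witness) : Prop :=
  feas_ok Hw W /\
  [/\ EC1 Hw Hr W, EC2 Hr W, EC3 Hw Hr W, EC4 Hw Hr W & EC5 Hw Hr W].

Definition exchange_closure (Hw Hr : target) : Prop :=
  dominance Hw Hr /\ exists W : witness, admissible Hw Hr W.

(* Main.v *)
Require Import Defs.
From mathcomp Require Import all_boot all_order all_algebra.
From mathcomp Require Import lra.
Import Order.TTheory GRing.Theory Num.Theory.
Local Open Scope ring_scope.

(** Deleting one member of [X_n] leaves [n - 1] members of total value at most
    [Hw (n - 1)], so each member is worth at least the last slope [h_n].  When
    [h_n > rho_1] this exceeds the largest value a short member can have: all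
    of [X_n] is long.  Consequently every overlap [O_{n,m}], consisting of
    short members, is empty, and, feasibility being downward closed, no pair of
    members is feasible.  The exchange conditions then simplify, for each
    [r]-vertex [m], to

      [Hw n - x_i + Hr m <= bar Hw (n - 1 + m)]   for every [i],
      [x_y + Hr m <= bar Hw (m + 1)]              for every [y], if [n >= 3],

    the point of [n >= 3] being that a pair avoiding [y] exists.  Both bounds
    also hold at [m = 0], by (EC1).  Averaging them over [X_n], whose mean
    value is [Hw n / n], gives the two conclusions at [0] and at the
    [r]-vertices.

    The remaining [m] follow by a discrete minimum principle
    ([ge_at_vertices]): [bar Hw] is concave, while [Hr] is affine between
    consecutive vertices, so their difference is concave there and its sign is
    controlled by the vertices. *)

(** The truncation [bar H] is concave on all of [nat]: beyond [bound H] the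
    slope drops to [0], which is below the earlier, positive slopes. *)
Lemma bar_concave (H : target) k :
  bar H k.+2 - bar H k.+1 <= bar H k.+1 - bar H k.
Proof.
have [lt_kb | le_bk] := ltnP k.+1 (bound H).
  rewrite /bar (minn_idPl lt_kb) (minn_idPl (ltnW lt_kb)).
  by rewrite (minn_idPl (ltnW (ltnW lt_kb))) (@tval_concave H k.+1).
have -> : bar H k.+2 = bar H k.+1 by rewrite /bar !(minn_idPr _) // ltnW.
rewrite subrr subr_ge0 /bar (minn_idPr le_bk).
have [lt_kb | //] := ltnP k (bound H).
have <- : k.+1 = bound H by apply/eqP; rewrite eqn_leq lt_kb.
by rewrite ltW // tval_incr.
Qed.

(** Where [f - H] is negative, at [k + 1], there is no vertex, so the slope of
    [H] is unchanged after [k + 1] while that of [f] does not grow.  A strict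
    decrease from [k] to [k + 1] therefore goes on up to [bound H], which is a
    vertex: a contradiction. *)
Lemma no_descent (H : target) (f : nat -> rat) :
    (forall k, f k.+2 - f k.+1 <= f k.+1 - f k) ->
    (forall m, vertex H m -> H m <= f m) ->
  forall k, (k < bound H)%N -> f k.+1 < H k.+1 ->
    f k.+1 - f k < H k.+1 - H k -> False.
Proof.
move=> f_concave f_ge k; move def_d: (bound H - k)%N => d.
elim: d k def_d => [|d IHd] k def_d lt_kb neg decr.
  by move: lt_kb; rewrite -subn_gt0 def_d.
have := contraNN (f_ge k.+1); rewrite -ltNge => /(_ neg).
rewrite /vertex ltn0Sn lt_kb /= negb_or negbK => /andP[neq_kb /eqP].
rewrite /slope /= => eq_slope.
have {neq_kb lt_kb} lt_kb : (k.+1 < bound H)%N by rewrite ltn_neqAle neq_kb.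
have fc := f_concave k.
apply: (IHd k.+1) => //; first by rewrite subnS def_d.
all: lra.
Qed.

(** At the first failure [f - H] has just turned from nonnegative to negative,
    a descent of the kind that [no_descent] excludes. *)
Lemma ge_at_vertices (H : target) (f : nat -> rat) :
    (forall k, f k.+2 - f k.+1 <= f k.+1 - f k) ->
    (forall m, m = 0%N \/ vertex H m -> H m <= f m) ->
  forall m, (m <= bound H)%N -> H m <= f m.
Proof.
move=> f_concave f_ge; elim=> [_ | m IHm lt_mb]; first by apply: f_ge; left.
have ge_m := IHm (ltnW lt_mb).
rewrite leNgt; apply/negP => neg.
apply: (@no_descent H f f_concave _ m) => // [k vk|]; last by lra.
by apply: f_ge; right.
Qed.

Lemma le_mean n (x : 'I_n -> rat) c :
  (0 < n)%N -> (forall i, c <= x i) -> c <= (\sum_i x i) / n%:R.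
Proof.
move=> n_gt0 le_cx; rewrite ler_pdivlMr ?ltr0n // mulr_natr.
by rewrite -[n in c *+ n]card_ord -sumr_const ler_sum.
Qed.

Lemma ge_mean n (x : 'I_n -> rat) c :
  (0 < n)%N -> (forall i, x i <= c) -> (\sum_i x i) / n%:R <= c.
Proof.
move=> n_gt0 le_xc; rewrite ler_pdivrMr ?ltr0n // mulr_natr.
by rewrite -[n in c *+ n]card_ord -sumr_const ler_sum.
Qed.

Lemma vertex_gt0 {H : target} {n} : vertex H n -> (0 < n)%N.
Proof. by case/and3P. Qed.

Lemma vertex_le_bound {H : target} {n} : vertex H n -> (n <= bound H)%N.
Proof. by case/and3P. Qed.

Section AllLong.

Context {Hw Hr : target} {W : witness} {n : nat}.
Hypotheses (adm : admissible Hw Hr W) (wn : vertex Hw n).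

(** The subset bound of (EC1), applied to the complement of [i]. *)
Lemma remove_one_le (i : 'I_n) : Hw n - xval W i <= bar Hw n.-1.
Proof.
case: adm => _ [/(_ n wn)[_ _ sum_x le_x _] _ _ _ _].
have := le_x [set~ i]; rewrite cardsC1 card_ord; congr (_ <= _).
rewrite -sum_x [in RHS](bigD1 i) //= addrAC subrr add0r.
by apply: eq_bigl => j; rewrite !inE.
Qed.

Hypothesis steep : slope1 Hr < slope Hw n.

Lemma all_long : short W n = set0.
Proof.
case: adm => _ [/(_ n wn)[_ short_le _ _ _] _ _ _ _].
apply/setP => i; rewrite inE; apply/negP => /short_le x_le.
have := remove_one_le i; rewrite /bar (minn_idPl _); last first.
  by apply: leq_trans (vertex_le_bound wn); exact: leq_pred.
by move: steep; rewrite /slope; lra.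
Qed.

Lemma ovl_empty m : vertex Hr m -> ovl W n m = set0.
Proof.
case: adm => _ [_ _ ec3 _ _] rm; case: (ec3 n m wn rm) => _ _ + _.
by rewrite all_long subset0 => /eqP.
Qed.

Lemma pair_infeasible (i i' : 'I_n) : [set i; i'] \notin feas W n.
Proof.
case: adm => /(_ n wn)[_ feas_sub feas1] _.
have sub : [set i] \subset [set i; i'] by rewrite sub1set !inE eqxx.
apply/negP => /(feas_sub _ _ sub).
by rewrite feas1 all_long inE.
Qed.

(** With the overlap empty this is (EC4) at an [r]-vertex; at [m = 0] it is
    [remove_one_le]. *)
Lemma exchange_remove m (i : 'I_n) : m = 0%N \/ vertex Hr m ->
  Hw n - xval W i + Hr m <= bar Hw (n.-1 + m).
Proof.
case=> [-> | rm]; first by rewrite tval0 addr0 addn0 remove_one_le.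
case: (adm) => _ [_ _ _ ec4 _].
have long_i : i \notin short W n by rewrite all_long inE.
have := ec4 n m wn rm i long_i; rewrite big1 => [|[j j_ovl] _].
  by rewrite subr0 (ovl_empty m rm) cards0 subn0.
by exfalso; move: j_ovl; rewrite (ovl_empty m rm) inE.
Qed.

(** At an [r]-vertex this is (EC5) for any two members other than [y], which
    form an infeasible pair; at [m = 0] it is the bound of (EC1) on [y]. *)
Lemma exchange_add m (y : 'I_n) : (3 <= n)%N -> m = 0%N \/ vertex Hr m ->
  xval W y + Hr m <= bar Hw m.+1.
Proof.
move=> n_ge3 [-> | rm].
  case: (adm) => _ [/(_ n wn)[_ _ _ le_x _] _ _ _ _].
  by have := le_x [set y]; rewrite big_set1 cards1 tval0 addr0.
case: (adm) => _ [_ _ _ _ ec5].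
have /card_gt1P[i [i' [i_y i'_y neq_ii']]] : (1 < #|[set~ y]|)%N.
  by rewrite cardsC1 card_ord; case: (n) n_ge3 => [|[]].
apply: (ec5 n m wn rm i i' neq_ii' (pair_infeasible i i')).
rewrite (ovl_empty m rm) setU0 !inE negb_or.
by move: i_y i'_y; rewrite !inE !(eq_sym y) => -> ->.
Qed.

End AllLong.

Theorem corollary3p4 (Hw Hr : target) (n : nat)
    (hEC : exchange_closure Hw Hr)
    (hn : vertex Hw n)
    (hslope : slope1 Hr < slope Hw n) :
  (forall m : nat, (m <= bound Hr)%N ->
     bar Hw (n.-1 + m) >= n.-1%:R / n%:R * Hw n + Hr m) /\
  ((3 <= n)%N -> forall m : nat, (m <= bound Hr)%N ->
     bar Hw m.+1 >= 1 / n%:R * Hw n + Hr m).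
Proof.
case: hEC => _ [W adm]; have n_gt0 := vertex_gt0 hn.
have sum_x : \sum_(i < n) xval W i = Hw n.
  by case: adm => _ [/(_ n hn)[]].
split=> [m le_mb | n_ge3 m le_mb].
  have -> : n.-1%:R / n%:R * Hw n = Hw n - Hw n / n%:R.
    rewrite -subn1 natrB // mulrBl mulfV ?pnatr_eq0 -?lt0n //.
    by rewrite mulrBl !mul1r mulrC.
  rewrite addrC -lerBrDr.
  apply: (ge_at_vertices Hr (fun k => bar Hw (n.-1 + k) - _)) le_mb.
    by move=> k; have := bar_concave Hw (n.-1 + k); rewrite !addnS; lra.
  move=> k hk; suff: Hw n + Hr k - bar Hw (n.-1 + k) <= Hw n / n%:R by lra.
  rewrite -[in X in _ <= X]sum_x; apply: le_mean => // i.
  by have := exchange_remove adm hn hslope k i hk; lra.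
rewrite mulrC mulrA mulr1 addrC -lerBrDr.
apply: (ge_at_vertices Hr (fun k => bar Hw k.+1 - _)) le_mb.
  by move=> k; have := bar_concave Hw k.+1; lra.
move=> k hk; suff: Hw n / n%:R <= bar Hw k.+1 - Hr k by lra.
rewrite -sum_x; apply: ge_mean => // y.
by have := exchange_add adm hn hslope k y n_ge3 hk; lra.
Qed.
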